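(* Let $M$ and $N$ be two semilattice models over the finite sets of constants $C_M=\{a_1,\dots,a_m\}$ and $C_N=\{b_1,\dots,b_n\}$, respectively, such that $C_M\cap C_N=\emptyset$. Let $G$ be the set of $m\times n$ constants $g_{ij}=(a_i,b_j)$. The product model $M\otimes N$ generated by $G$ satisfies: (i) $M\otimes N=\Big(\prod_{i=1}^m\prod_{j=1}^n\square_{g_{ij}\le a_i\odot b_j}\,\square_{a_i\odot b_j\le g_{ij}}\,(M+N+F_G(\emptyset))\Big)^{|G}$, where products denote composition of operators. (ii) $M\otimes N=\big[\tfrac{g_{1,1}g_{1,2}\dots g_{1,n}}{a_1}\,\tfrac{g_{2,1}g_{2,2}\dots g_{2,n}}{a_2}\cdots\tfrac{g_{m,1}g_{m,2}\dots g_{m,n}}{a_m}\big]\big[\tfrac{g_{1,1}g_{2,1}\dots g_{m,1}}{b_1}\,\tfrac{g_{1,2}g_{2,2}\dots g_{m,2}}{b_2}\cdots\tfrac{g_{1,n}g_{2,n}\dots g_{m,n}}{b_n}\big](M+N)$. (iii) $M\otimes N$ can be atomized with as few non-redundant atoms as the number of non-redundant atoms of $M$ plus the number of non-redundant atoms of $N$.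
   Context: A semilattice is a nonempty set with a commutative, associative, idempotent operation $\odot$, ordered by $a\le b$ iff $a\odot b=b$. For a finite set $C$ of constants, $F_C(\emptyset)$ is the free semilattice on $C$; its elements (terms) $t$ are identified with their nonempty sets $\mathbf{C}(t)\subseteq C$ of component constants. A model over $C$ is a semilattice $M$ with a map $C\to M$ whose image generates $M$; it induces the natural homomorphism $\nu_M:F_C(\emptyset)\to M$. Models over the same constants are regarded as equal if they satisfy the same inequalities between terms. For $Q\subseteq C$, $M^{|Q}$ is the subalgebra of $M$ generated by $Q$, viewed as a model over $Q$. The product $M\otimes N$ is the direct product semilattice (componentwise $\odot$ and order), viewed as a model over $G$ in which $g_{ij}$ is interpreted as the pair $(a_i,b_j)$; these generate it. An atom $\phi$ over $C$ is determined by a nonempty subset $\mathbf{U}^c(\phi)\subseteq C$; $\phi<t$ means $\mathbf{C}(t)\cap\mathbf{U}^c(\phi)\ne\emptyset$. A set $A$ of atoms over $C$ atomizes $M$ ($M=[A]$) if every $c\in C$ satisfies $\phi<c$ for some $\phi\in A$, and for all terms $t,s$: $\nu_M(t)\le\nu_M(s)$ iff there is no $\phi\in A$ with $\phi<t$, $\phi\not<s$. An atom is in $M$ if it belongs to some set of atoms atomizing $M$; an atom $\phi$ is redundant with $M$ if for each $c$ with $\phi<c$ there is $\eta$ in $M$ with $\eta<c$ and $\mathbf{U}^c(\eta)\subsetneq\mathbf{U}^c(\phi)$; the non-redundant atoms of $M$ are the atoms in $M$ not redundant with $M$. Union model: for models $[A]$ over $C_1$ and $[B]$ over $C_2$, $[A]+[B]$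 is the model $[A\cup B]$ over $C_1\cup C_2$ (independent of the choice of $A,B$). Full crossing: for terms $r_L,r_R$ and a model $K=[A]$, put $H=\{\phi\in A:\phi<r_L,\phi\not<r_R\}$ and $B=\{\phi\in A:\phi<r_R\}$; $\square_{r_L\le r_R}K$ is the model atomized by $(A\setminus H)\cup\{\lambda\bigtriangledown\rho:\lambda\in H,\rho\in B\}$, where $\mathbf{U}^c(\lambda\bigtriangledown\rho)=\mathbf{U}^c(\lambda)\cup\mathbf{U}^c(\rho)$ (as a model it does not depend on $A$). Rename: an operator $\big[\tfrac{X_1}{c_1}\tfrac{X_2}{c_2}\cdots\big]$, with $X_k$ a list of new constants, acts on an atom by replacing each $c_k$ in its upper set $\mathbf{U}^c(\phi)$ by all constants of $X_k$; it acts on a model by acting on all the atoms of an atomization and replacing the constants $c_k$ by the new ones. The constants $g_{ij}$ are distinct from the $a_i$ and $b_j$. *)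

(* Defs.v *)
From HB Require Import structures.
From mathcomp Require Import all_boot all_order.

Set Implicit Arguments.
Unset Strict Implicit.
Unset Printing Implicit Defensive.

Import Order.Theory Order.SetSubsetOrder.Exports.
Local Open Scope order_scope.

(* All constants live in a finite type Omega; a set of constants is a nonempty
   subset of Omega.  Nonempty sets of constants also serve as terms (t stands
   for its set C(t) of component constants) and as atoms (phi stands for its
   upper set U^c(phi)). *)
Record neset (Omega : finType) :=
  NeSet { nval :> {set Omega}; nvalP : nval != set0 }.

HB.instance Definition _ (Omega : finType) := [isSub for @nval Omega].
HB.instance Definition _ (Omega : finType) := [Finite of neset Omega by <:].

Notation term := neset (only parsing).
Notation atom := neset (only parsing).

(* {set T} ordered by inclusion, with union as join. *)
Notation subsets T :=
  (Order.SetSubsetOrder.type Order.SetSubsetOrder.subset_display T).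

Section NeSet.
Variable Omega : finType.
Implicit Types (s t U : neset Omega) (c : Omega).

Fact ne1_subproof c : [set c] != set0.
Proof. by apply/set0Pn; exists c; rewrite inE. Qed.
Definition ne1 c := NeSet (ne1_subproof c).

Fact neU_subproof s t : nval s :|: nval t != set0.
Proof. by case/set0Pn: (nvalP s) => c sc; apply/set0Pn; exists c; rewrite inE sc. Qed.
Definition neU s t := NeSet (neU_subproof s t).

Fact nemap_subproof (I : finType) (f : I -> Omega) (S : neset I) :
  [set f x | x in nval S] != set0.
Proof.
by case/set0Pn: (nvalP S) => c sc; apply/set0Pn; exists (f c); apply: imset_f.
Qed.
Definition nemap (I : finType) (f : I -> Omega) (S : neset I) :=
  NeSet (nemap_subproof f S).

Fact nemap2_subproof (g : Omega -> Omega -> Omega) s t :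
  [set g x y | x in nval s, y in nval t] != set0.
Proof.
case/set0Pn: (nvalP s) => c sc; case/set0Pn: (nvalP t) => d td.
by apply/set0Pn; exists (g c d); apply: imset2_f.
Qed.
Definition nemap2 g s t := NeSet (nemap2_subproof g s t).

Definition nepick s : Omega := xchoose (set0Pn _ (nvalP s)).

Lemma nepickP s : nepick s \in nval s.
Proof. exact: xchooseP. Qed.

(* [rename_set D X U] replaces simultaneously each c in D by all the constants
   of X c. *)
Fact rename_set_subproof (D : {set Omega}) (X : Omega -> neset Omega) U :
  (nval U :\: D) :|: \bigcup_(c in nval U :&: D) nval (X c) != set0.
Proof.
have Up := nepickP U; apply/set0Pn.
case: (boolP (nepick U \in D)) => [Dp|nDp]; last first.
  by exists (nepick U); rewrite !inE nDp Up.
exists (nepick (X (nepick U))); rewrite inE; apply/orP; right.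
by apply/bigcupP; exists (nepick U); [rewrite inE Up | exact: nepickP].
Qed.
Definition rename_set D X U := NeSet (rename_set_subproof D X U).

End NeSet.

Section Joins.
Context {d : Order.disp_t} {L : joinSemilatticeType d} {Omega : finType}.
Variable f : Omega -> L.

(* A join semilattice need not have a bottom, so the big join starts from the
   value of a member of t; this is harmless by idempotence. *)
Definition joins (t : term Omega) : L :=
  \big[Order.join/f (nepick t)]_(c in nval t) f c.

(* The subalgebra generated by the image of C. *)
Inductive generated (C : neset Omega) : L -> Prop :=
| GenConst c : c \in nval C -> generated C (f c)
| GenJoin x y : generated C x -> generated C y -> generated C (x `|` y).

Definition generatedb (C : neset Omega) : pred L := fun x =>
  [exists t : term Omega, (nval t \subset nval C) && (x == joins t)].

Lemma joins_le t z : (joins t <= z) = [forall (c | c \in nval t), f c <= z].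
Proof.
have big_le (r : seq Omega) (P : pred Omega) x0 :
    (\big[Order.join/x0]_(c <- r | P c) f c <= z)
    = (x0 <= z) && all (fun c => P c ==> (f c <= z)) r.
  elim: r => [|c r IH]; first by rewrite big_nil andbT.
  by rewrite big_cons /=; case: (P c) => //=; rewrite leUx IH andbCA.
rewrite /joins big_le; apply/andP/forall_inP => [[_ /allP H] c tc|H].
  by apply: (implyP (H c _)) => //; rewrite mem_index_enum.
split; first exact/H/nepickP.
by apply/allP => c _; apply/implyP; exact: H.
Qed.

Lemma le_joins t c : c \in nval t -> f c <= joins t.
Proof. by move: (joins_le t (joins t)); rewrite lexx => /esym/forall_inP; apply. Qed.

Lemma joins1 c : joins (ne1 c) = f c.
Proof.
apply/le_anti/andP; split; last by apply: le_joins; rewrite inE.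
by rewrite joins_le; apply/forall_inP => x /set1P->.
Qed.

Lemma joinsU s t : joins (neU s t) = joins s `|` joins t.
Proof.
apply/le_anti/andP; split.
  rewrite joins_le; apply/forall_inP => x /setUP[] /le_joins/le_trans; apply.
    exact: leUl.
  exact: leUr.
rewrite leUx !joins_le; apply/andP; split; apply/forall_inP => x xs;
  by apply: le_joins; rewrite inE xs ?orbT.
Qed.

Lemma generatedP C x : reflect (generated C x) (generatedb C x).
Proof.
apply: (iffP existsP) => [[t /andP[tC /eqP->]]|]; last first.
  elim=> [c Cc|{}x y _ [s /andP[sC /eqP->]] _ [t /andP[tC /eqP->]]].
    by exists (ne1 c); rewrite joins1 eqxx sub1set Cc.
  by exists (neU s t); rewrite joinsU eqxx subUset sC tC.
rewrite /joins; elim/big_rec: _ => [|c y tc Gy].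
  by apply: GenConst; apply: (subsetP tC); exact: nepickP.
by apply: GenJoin => //; apply: GenConst; apply: (subsetP tC).
Qed.

End Joins.

Section GeneratedSubalgebra.
Context {d : Order.disp_t} {L : joinSemilatticeType d} {Omega : finType}.
Variables (f : Omega -> L) (C : neset Omega).

Record gensub := GenSub { gensub_val : L; gensub_valP : generatedb f C gensub_val }.

HB.instance Definition _ := [isSub for gensub_val].
HB.instance Definition _ := [Choice of gensub by <:].

Fact gensub_join_subproof (x y : gensub) :
  generatedb f C (gensub_val x `|` gensub_val y).
Proof. by apply/generatedP/GenJoin; apply/generatedP; exact: gensub_valP. Qed.

Definition gensub_le (x y : gensub) := gensub_val x <= gensub_val y.
Definition gensub_join (x y : gensub) := GenSub (gensub_join_subproof x y).

Fact gensub_le_refl : reflexive gensub_le. Proof. by move=> x; exact: lexx. Qed.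
Fact gensub_le_anti : antisymmetric gensub_le.
Proof. by move=> x y H; apply/val_inj/le_anti. Qed.
Fact gensub_le_trans : transitive gensub_le.
Proof. by move=> y x z; exact: le_trans. Qed.

HB.instance Definition _ :=
  Order.Le_isPOrder.Build d gensub gensub_le_refl gensub_le_anti gensub_le_trans.

Fact gensub_leUx (x y z : gensub) :
  (gensub_join x y <= z) = (x <= z) && (y <= z).
Proof. exact: leUx. Qed.

HB.instance Definition _ :=
  Order.POrder_isJoinSemilattice.Build d gensub gensub_leUx.

Fact gensub_const_subproof c :
  generatedb f C (f (if c \in nval C then c else nepick C)).
Proof.
apply/generatedP/GenConst; case: ifP => // _; exact: nepickP.
Qed.
Definition gensub_const c : gensub := GenSub (gensub_const_subproof c).

Lemma gensub_valU (x y : gensub) :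
  gensub_val (x `|` y) = gensub_val x `|` gensub_val y.
Proof. by []. Qed.

Fact gensub_generated (x : gensub) : generated gensub_const C x.
Proof.
case: x => x Hx; have /generatedP Gx := Hx.
elim: Gx Hx => [c Cc|{}x y Gx IHx Gy IHy] Hx.
  have -> : GenSub Hx = gensub_const c by apply: val_inj; rewrite /= Cc.
  exact: GenConst.
have Hx' : generatedb f C x by apply/generatedP.
have Hy' : generatedb f C y by apply/generatedP.
have -> : GenSub Hx = (GenSub Hx' : gensub) `|` GenSub Hy' by exact: val_inj.
by apply: GenJoin; [apply: IHx | apply: IHy].
Qed.

End GeneratedSubalgebra.

(* A model over the constants [consts]: only the values of [interp] on [consts]
   are meaningful.  The carrier is nonempty because [consts] is. *)
Record model (Omega : finType) := Model {
  consts : neset Omega;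
  mdisp : Order.disp_t;
  carrier : joinSemilatticeType mdisp;
  interp : Omega -> carrier;
  interp_generates : forall x : carrier, generated interp consts x
}.

(* The natural homomorphism, meaningful on the terms over [consts M]. *)
Definition nu (Omega : finType) (M : model Omega) (t : term Omega) : carrier M :=
  joins (@interp Omega M) t.

Definition model_eq (Omega : finType) (M N : model Omega) : Prop :=
  consts M = consts N /\
  forall t s : term Omega,
    nval t \subset nval (consts M) -> nval s \subset nval (consts M) ->
    (nu M t <= nu M s) = (nu N t <= nu N s).

Notation "M ≡ N" := (model_eq M N) (at level 70, N at next level).

Section Models.
Variable Omega : finType.
Implicit Types (M N K : model Omega) (C Q : neset Omega).
Implicit Types (s t : term Omega) (phi : atom Omega) (A B : {set atom Omega}).

Definition gen_model d (L : joinSemilatticeType d) C (f : Omega -> L) :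
    model Omega :=
  Model (@gensub_generated d L Omega f C).

(* Meant for Q \subset consts M. *)
Definition restrict Q M : model Omega := gen_model Q (@interp Omega M).

(* Terms over C are the nonempty subsets of C, i.e. the subsets of Omega
   generated under union by the singletons of members of C. *)
Definition free_model C : model Omega :=
  gen_model C (fun c => [set c] : subsets Omega).

Definition below phi t : bool := ~~ [disjoint nval t & nval phi].

Definition atomizes A M : bool :=
  [&& [forall (phi | phi \in A), nval phi \subset nval (consts M)],
      [forall (c | c \in nval (consts M)), exists (phi | phi \in A), below phi (ne1 c)]
    & [forall (t : term Omega | nval t \subset nval (consts M)),
       forall (s : term Omega | nval s \subset nval (consts M)),
         (nu M t <= nu M s)
         == ~~ [exists (phi | phi \in A), below phi t && ~~ below phi s]]].

Definition atoms_in M : {set atom Omega} :=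
  [set phi | [exists A, atomizes A M && (phi \in A)]].

Definition redundant phi M : bool :=
  [forall (c | c \in nval (consts M)), below phi (ne1 c) ==>
    [exists (eta | eta \in atoms_in M),
       below eta (ne1 c) && (nval eta \proper nval phi)]].

Definition nonredundant M : {set atom Omega} :=
  [set phi in atoms_in M | ~~ redundant phi M].

Definition atoms_below_const A c : subsets (atom Omega) :=
  [set phi in A | below phi (ne1 c)].

(* The model [A] over C: a term t is sent to the set of the phi in A with
   phi < t, ordered by inclusion. *)
Definition of_atoms C A : model Omega := gen_model C (atoms_below_const A).

(* The next three operators are defined through the atomization [atoms_in] of
   their arguments; [union_atomizes], [cross_atomizes] and [rename_atomizes]
   show that any other atomization gives the same model. *)
Definition union M N : model Omega :=
  of_atoms (neU (consts M) (consts N)) (atoms_in M :|: atoms_in N).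

Definition cross_atoms (rL rR : term Omega) A : {set atom Omega} :=
  let H := [set phi in A | below phi rL && ~~ below phi rR] in
  let B := [set phi in A | below phi rR] in
  (A :\: H) :|: [set neU lambda rho | lambda in H, rho in B].

Definition cross (rL rR : term Omega) K : model Omega :=
  of_atoms (consts K) (cross_atoms rL rR (atoms_in K)).

Definition rename (D : {set Omega}) (X : Omega -> neset Omega) K : model Omega :=
  of_atoms (rename_set D X (consts K))
           [set rename_set D X phi | phi in atoms_in K].

End Models.

Section Product.
Variables (Omega : finType) (M N : model Omega) (g : Omega -> Omega -> Omega).
Hypothesis g_inj : {in setX (nval (consts M)) (nval (consts N)) &,
                      injective (fun p => g p.1 p.2)}.

Definition prod_consts : neset Omega := nemap2 g (consts M) (consts N).

Definition prod_interp (c : Omega) : (carrier M *p carrier N)%type :=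
  let p := odflt (c, c) [pick p in setX (nval (consts M)) (nval (consts N))
                         | g p.1 p.2 == c] in
  (interp M p.1, interp N p.2).

Lemma prod_interpE a b :
  a \in nval (consts M) -> b \in nval (consts N) ->
  prod_interp (g a b) = (interp M a, interp N b).
Proof.
move=> Ma Nb; have Dab : (a, b) \in setX (nval (consts M)) (nval (consts N)).
  by rewrite in_setX Ma Nb.
rewrite /prod_interp; case: pickP => [p /andP[Dp /eqP gp]|/(_ (a, b))] /=.
  by have -> : p = (a, b) by apply: g_inj.
by rewrite Dab eqxx.
Qed.

Fact prod_generated x : generated prod_interp prod_consts x.
Proof.
case: x => x y; elim: (interp_generates x) => [a Ma|x1 x2 _ IH1 _ IH2].
  elim: (interp_generates y) => [b Nb|y1 y2 _ IH1 _ IH2].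
    by rewrite -prod_interpE //; apply: GenConst; apply: imset2_f.
  by have := GenJoin IH1 IH2; rewrite joinEprod /= joinxx.
by have := GenJoin IH1 IH2; rewrite joinEprod /= joinxx.
Qed.

Definition prod_model : model Omega := Model prod_generated.

End Product.

(* Atomizations exist, and the operators above do not depend on their choice. *)
Section Atomizations.
Variable Omega : finType.
Implicit Types (M N K : model Omega) (C : neset Omega).
Implicit Types (s t : term Omega) (phi : atom Omega) (A B : {set atom Omega}).

Definition separates A t s : bool :=
  [exists (phi | phi \in A), below phi t && ~~ below phi s].

Lemma belowP phi t :
  reflect (exists2 c, c \in nval t & c \in nval phi) (below phi t).
Proof.
rewrite /below disjoint_subset; apply: (iffP subsetPn) => [[c]|[c tc pc]].
  by rewrite !inE negbK; exists c.
by exists c; rewrite ?inE ?negbK.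
Qed.

Lemma below1 phi c : below phi (ne1 c) = (c \in nval phi).
Proof.
apply/belowP/idP => [[x /set1P-> //]|pc]; exists c => //; exact: set11.
Qed.

Lemma below_neU phi psi t : below (neU phi psi) t = below phi t || below psi t.
Proof.
apply/belowP/orP => [[c tc /setUP[]]|[] /belowP[c tc pc]].
- by left; apply/belowP; exists c.
- by right; apply/belowP; exists c.
- by exists c => //; rewrite inE pc.
- by exists c => //; rewrite inE pc orbT.
Qed.

Lemma below_term_neU phi s t : below phi (neU s t) = below phi s || below phi t.
Proof.
apply/belowP/orP => [[c /setUP[]]|[] /belowP[c tc pc]].
- by left; apply/belowP; exists c.
- by right; apply/belowP; exists c.
- by exists c => //; rewrite inE tc.
- by exists c => //; rewrite inE tc orbT.
Qed.

Lemma gen_model_le d (L : joinSemilatticeType d) C (f : Omega -> L) t s :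
  nval t \subset nval C -> nval s \subset nval C ->
  (nu (gen_model C f) t <= nu (gen_model C f) s) = (joins f t <= joins f s).
Proof.
have E u : nval u \subset nval C ->
    gensub_val (nu (gen_model C f) u : gensub f C) = joins f u.
  move=> uC; apply/le_anti/andP; split.
    have Hs : generatedb f C (joins f u).
      by apply/existsP; exists u; rewrite uC eqxx.
    suff: nu (gen_model C f) u <= (GenSub Hs : gensub f C) by [].
    rewrite /nu joins_le; apply/forall_inP => c uc.
    have Cc := subsetP uC _ uc.
    rewrite [_ <= _]/(gensub_val (gensub_const f C c) <= joins f u) /= Cc.
    exact: le_joins.
  rewrite joins_le; apply/forall_inP => c uc.
  have := @le_joins _ _ _ (@interp _ (gen_model C f)) u c uc.
  by rewrite [_ <= _]/(f (if c \in nval C then _ else _) <= _) (subsetP uC _ uc).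
by move=> tC sC; rewrite -(E t) // -(E s).
Qed.

Lemma of_atoms_le C A t s :
  nval t \subset nval C -> nval s \subset nval C ->
  (nu (of_atoms C A) t <= nu (of_atoms C A) s) = ~~ separates A t s.
Proof.
move=> tC sC; rewrite gen_model_le //; set f := atoms_below_const A.
have E u : joins f u = [set phi in A | below phi u].
  apply/le_anti/andP; split.
    rewrite joins_le; apply/forall_inP => c uc; apply/subsetP => phi.
    rewrite !inE below1 => /andP[-> pc]; apply/belowP; by exists c.
  apply/subsetP => phi; rewrite inE => /andP[Aphi /belowP[c uc pc]].
  by apply: (subsetP (le_joins f uc)); rewrite inE Aphi below1.
rewrite !E; apply/subsetP/existsPn => [H phi|H phi].
  apply/negP => /and3P[Aphi pt /negP[]].
  by have := H phi; rewrite !inE Aphi pt => /(_ isT).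
rewrite !inE => /andP[Aphi pt]; rewrite Aphi /=.
by have := H phi; rewrite Aphi pt /= negbK.
Qed.

Lemma atomizesP A M :
  reflect [/\ forall phi, phi \in A -> nval phi \subset nval (consts M),
              forall c, c \in nval (consts M) ->
                exists2 phi, phi \in A & c \in nval phi
            & forall t s, nval t \subset nval (consts M) ->
                nval s \subset nval (consts M) ->
                (nu M t <= nu M s) = ~~ separates A t s]
          (atomizes A M).
Proof.
apply: (iffP and3P) => [[/forall_inP H1 /forall_inP H2 /forall_inP H3]|[H1 H2 H3]].
  split=> // [c /H2/exists_inP[phi Aphi]|t s tC sC].
    by rewrite below1; exists phi.
  by have /forall_inP/(_ s sC)/eqP := H3 t tC.
split; apply/forall_inP => //.
  move=> c /H2[phi Aphi pc]; apply/exists_inP; exists phi => //.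
  by rewrite below1.
by move=> t tC; apply/forall_inP => s sC; rewrite H3.
Qed.

Lemma of_atoms_atomizes C A :
  (forall phi, phi \in A -> nval phi \subset nval C) ->
  (forall c, c \in nval C -> exists2 phi, phi \in A & c \in nval phi) ->
  atomizes A (of_atoms C A).
Proof. by move=> AC CA; apply/atomizesP; split=> //; exact: of_atoms_le. Qed.

(* The atoms in M are the atoms over its constants consistent with its order. *)
Definition consistent M phi : bool :=
  (nval phi \subset nval (consts M)) &&
  [forall (t : term Omega | nval t \subset nval (consts M)),
     forall (s : term Omega | nval s \subset nval (consts M)),
       (nu M t <= nu M s) ==> below phi t ==> below phi s].

Lemma consistentP M phi :
  reflect (nval phi \subset nval (consts M) /\
           forall t s, nval t \subset nval (consts M) ->
             nval s \subset nval (consts M) ->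
             nu M t <= nu M s -> below phi t -> below phi s)
          (consistent M phi).
Proof.
apply: (iffP andP) => -[pC H]; split=> //.
  move=> t s tC sC ts pt; move/forall_inP/(_ t tC)/forall_inP/(_ s sC): H.
  by rewrite ts pt.
apply/forall_inP => t tC; apply/forall_inP => s sC.
by apply/implyP => ts; apply/implyP; exact: H ts.
Qed.

Lemma consistent_atomizes M : atomizes [set phi | consistent M phi] M.
Proof.
apply/atomizesP; split=> [phi|c Cc|t s tC sC].
- by rewrite inE => /consistentP[].
- exists (consts M) => //; rewrite inE; apply/consistentP; split=> // t s _ sC _ _.
  by apply/belowP; exists (nepick s); rewrite ?(subsetP sC) ?nepickP.
apply/idP/existsPn => [ts phi|H].
  rewrite inE; apply/negP => /and3P[/consistentP[_ H] pt /negP[]].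
  exact: H ts pt.
apply: contraT => Nts.
have [c /andP[tc Ncs]] : exists c, (c \in nval t) && ~~ (interp M c <= nu M s).
  apply/existsP; apply: contraR Nts; rewrite negb_exists => /forallP H'.
  rewrite /nu joins_le; apply/forall_inP => c tc.
  by have := H' c; rewrite tc negbK.
(* the atom of all constants not below s *)
pose U := [set x in nval (consts M) | ~~ (interp M x <= nu M s)].
have Uc : c \in U by rewrite inE Ncs (subsetP tC).
have U0 : U != set0 by apply/set0Pn; exists c.
have bU u : nval u \subset nval (consts M) ->
    below (NeSet U0) u = ~~ (nu M u <= nu M s).
  move=> uC; rewrite {2}/nu joins_le negb_forall.
  apply/belowP/existsP => [[x ux]|[x]].
    by rewrite inE => /andP[_ Nx]; exists x; rewrite ux.
  by rewrite negb_imply => /andP[ux Nx]; exists x; rewrite //= inE Nx (subsetP uC).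
have := H (NeSet U0); rewrite bU // bU // Nts lexx /= andbT inE => /negP[].
apply/consistentP; split=> [|u v uC vC uv].
  by apply/subsetP => x; rewrite inE => /andP[].
by rewrite !bU //; apply: contra; exact: le_trans.
Qed.

Lemma atoms_inE M : atoms_in M = [set phi | consistent M phi].
Proof.
apply/setP => phi; rewrite !inE; apply/existsP/idP => [[A /andP[/atomizesP[H1 _ H3]]]|cp].
  move=> Aphi; apply/consistentP; split=> [|t s tC sC]; first exact: H1.
  rewrite H3 // => /existsPn/(_ phi) H pt; move: H.
  by rewrite Aphi pt negbK.
by exists [set phi | consistent M phi]; rewrite consistent_atomizes inE.
Qed.

Lemma atoms_in_atomizes M : atomizes (atoms_in M) M.
Proof. by rewrite atoms_inE consistent_atomizes. Qed.

Lemma atomizes_sub A M : atomizes A M -> A \subset atoms_in M.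
Proof.
move=> AM; apply/subsetP => phi Aphi; rewrite inE; apply/existsP.
by exists A; rewrite AM.
Qed.

(* The atoms in M = [A] are unions of members of A. *)
Lemma atoms_in_cover A M phi c : atomizes A M -> phi \in atoms_in M ->
  c \in nval phi ->
  exists2 eta, eta \in A & (c \in nval eta) && (nval eta \subset nval phi).
Proof.
move=> /atomizesP[AC CA H]; rewrite atoms_inE inE => /consistentP[pC cp] pc.
have Cc := subsetP pC _ pc.
case: (boolP (nval (consts M) :\: nval phi == set0)) => [|S0].
  rewrite setD_eq0 => Cp; have [eta Aeta ec] := CA c Cc.
  by exists eta => //; rewrite ec (subset_trans (AC _ Aeta)).
pose s := NeSet S0; have sC : nval s \subset nval (consts M) by exact: subsetDl.
have cC : nval (ne1 c) \subset nval (consts M) by rewrite sub1set.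
have Nps : ~~ below phi s by apply/belowP => -[x /setDP[_ /negP]].
have : ~~ (nu M (ne1 c) <= nu M s).
  by apply: contra Nps => cs; apply: cp cs _; rewrite ?below1.
rewrite H // negbK => /exists_inP[eta Aeta]; rewrite below1 => /andP[ec Nes].
exists eta; rewrite // ec; apply/subsetP => x ex; apply: contraR Nes => Npx.
by apply/belowP; exists x; rewrite // inE Npx (subsetP (AC _ Aeta)).
Qed.

Lemma separates_sub A B t s : A \subset B -> separates A t s -> separates B t s.
Proof.
move=> AB /exists_inP[phi Aphi H]; apply/exists_inP; exists phi => //.
exact: (subsetP AB).
Qed.

Lemma separates_cover A B t s :
  (forall phi c, phi \in B -> c \in nval phi ->
     exists2 eta, eta \in A & (c \in nval eta) && (nval eta \subset nval phi)) ->
  separates B t s -> separates A t s.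
Proof.
move=> cov /exists_inP[phi Bphi /andP[/belowP[c tc pc] Nps]].
have [eta Aeta /andP[ec ep]] := cov phi c Bphi pc.
apply/exists_inP; exists eta => //; apply/andP; split.
  by apply/belowP; exists c.
by apply: contra Nps => /belowP[x sx ex]; apply/belowP; exists x; rewrite ?(subsetP ep).
Qed.

Lemma of_atoms_atomizes_sub C A B :
  A \subset B ->
  (forall phi, phi \in B -> nval phi \subset nval C) ->
  (forall c, c \in nval C -> exists2 phi, phi \in B & c \in nval phi) ->
  (forall phi c, phi \in B -> c \in nval phi ->
     exists2 eta, eta \in A & (c \in nval eta) && (nval eta \subset nval phi)) ->
  atomizes A (of_atoms C B).
Proof.
move=> AB BC CB cov; apply/atomizesP; split=> [phi /(subsetP AB)|c|t s tC sC].
- exact: BC.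
- move=> /CB[phi Bphi /(cov _ _ Bphi)[eta Aeta /andP[ec _]]]; by exists eta.
rewrite of_atoms_le //; congr (~~ _).
by apply/idP/idP; [exact: separates_cover | exact: separates_sub].
Qed.

Theorem union_atomizes A B M N :
  atomizes A M -> atomizes B N -> atomizes (A :|: B) (union M N).
Proof.
move=> AM BN; have /atomizesP[MC CM _] := atoms_in_atomizes M.
have /atomizesP[NC CN _] := atoms_in_atomizes N.
apply: of_atoms_atomizes_sub.
- by apply: setUSS; exact: atomizes_sub.
- move=> phi /setUP[/MC|/NC] /subset_trans; apply; [exact: subsetUl|exact: subsetUr].
- by move=> c /setUP[/CM|/CN] [phi H pc]; exists phi; rewrite // inE H ?orbT.
move=> phi c /setUP[] H pc.
  by have [eta ? ?] := atoms_in_cover AM H pc; exists eta; rewrite // inE; apply/orP; left.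
by have [eta ? ?] := atoms_in_cover BN H pc; exists eta; rewrite // inE; apply/orP; right.
Qed.

Lemma atoms_in_term_cover A K phi t : atomizes A K -> phi \in atoms_in K ->
  below phi t ->
  exists2 eta, eta \in A & below eta t && (nval eta \subset nval phi).
Proof.
move=> AK Kp /belowP[c tc pc]; have [eta Ae /andP[ec ep]] := atoms_in_cover AK Kp pc.
by exists eta; rewrite // ep andbT; apply/belowP; exists c.
Qed.

Lemma below_sub phi eta t :
  nval eta \subset nval phi -> below eta t -> below phi t.
Proof. by move=> ep /belowP[c tc ec]; apply/belowP; exists c; rewrite ?(subsetP ep). Qed.

Lemma cross_atomsP rL rR A phi :
  reflect ((phi \in A /\ (below phi rL -> below phi rR)) \/
           exists lambda rho, [/\ lambda \in A, below lambda rL, ~~ below lambda rR,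
             rho \in A & below rho rR /\ phi = neU lambda rho])
          (phi \in cross_atoms rL rR A).
Proof.
apply: (iffP setUP) => [[]|[]].
- rewrite !inE negb_and => /andP[+ Ap]; rewrite Ap /= negb_and negbK => H.
  by left; split=> // pL; move: H; rewrite pL.
- case/imset2P => l r; rewrite !inE => /and3P[Al lL lR] /andP[Ar rR' ->].
  by right; exists l, r.
- move=> [Ap H]; left; rewrite !inE Ap andbT /= negb_and negbK.
  by rewrite -implybE; apply/implyP.
move=> [l [r [Al lL lR Ar [rR' ->]]]]; right; apply/imset2P.
by exists l r; rewrite // inE ?Al ?lL ?lR ?Ar.
Qed.

Theorem cross_atomizes rL rR A K :
  nval rL \subset nval (consts K) -> nval rR \subset nval (consts K) ->
  atomizes A K -> atomizes (cross_atoms rL rR A) (cross rL rR K).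
Proof.
move=> rLC rRC AK; have /atomizesP[KC CK _] := atoms_in_atomizes K.
have subA phi : phi \in A -> phi \in atoms_in K by exact/subsetP/atomizes_sub.
have /atomizesP[_ CA _] := AK.
have cov phi c : phi \in cross_atoms rL rR (atoms_in K) -> c \in nval phi ->
    exists2 eta, eta \in cross_atoms rL rR A
               & (c \in nval eta) && (nval eta \subset nval phi).
  have coverB psi x : psi \in atoms_in K -> below psi rR -> x \in nval psi ->
      exists2 eta, eta \in cross_atoms rL rR A
               & (x \in nval eta) && (nval eta \subset nval psi).
    move=> Kp pR px; have [eta Ae /andP[ex ep]] := atoms_in_cover AK Kp px.
    have [r Ar /andP[rR' rp]] := atoms_in_term_cover AK Kp pR.
    case: (boolP (below eta rL && ~~ below eta rR)) => [/andP[eL eR]|].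
      exists (neU eta r); last by rewrite inE ex subUset ep rp.
      by apply/cross_atomsP; right; exists eta, r.
    rewrite negb_and negbK => H; exists eta; last by rewrite ex ep.
    by apply/cross_atomsP; left; split=> // eL; move: H; rewrite eL.
  case/cross_atomsP => [[Kp LR] pc|[l [r [Kl lL lR Kr [rR' ->]]]] /setUP[lc|rc]].
  - case: (boolP (below phi rR)) => [pR|NpR]; first exact: coverB.
    have [eta Ae /andP[ec ep]] := atoms_in_cover AK Kp pc.
    exists eta; rewrite ?ec ?ep //; apply/cross_atomsP; left; split=> // eL.
    by case/negP: NpR; apply: LR; apply: below_sub eL.
  - have [eta Ae /andP[ec el]] := atoms_in_cover AK Kl lc.
    have [r' Ar' /andP[rR'' r'r]] := atoms_in_term_cover AK Kr rR'.
    case: (boolP (below eta rL)) => eL.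
      exists (neU eta r'); last by rewrite inE ec setUSS.
      apply/cross_atomsP; right; exists eta, r'; split=> //.
      by apply: contra lR; apply: below_sub.
    exists eta; last by rewrite ec (subset_trans el) // subsetUl.
    by apply/cross_atomsP; left; split=> // eL'; rewrite eL' in eL.
  have [eta He /andP[ec er]] := coverB r c Kr rR' rc.
  by exists eta; rewrite // ec (subset_trans er) // subsetUr.
apply: of_atoms_atomizes_sub => //.
- apply/subsetP => phi /cross_atomsP[[/subA Kp H]|].
    by apply/cross_atomsP; left.
  move=> [l [r [/subA Kl lL lR /subA Kr H]]].
  by apply/cross_atomsP; right; exists l, r.
- move=> phi /cross_atomsP[[/KC //]|[l [r [/KC Kl _ _ /KC Kr [_ ->]]]]].
  by rewrite subUset Kl.
move=> c Cc; have [phi Kp pc] := CK c Cc.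
case: (boolP (below phi rL && ~~ below phi rR)) => [/andP[pL pR]|].
  have [r Kr rR'] := CK _ (subsetP rRC _ (nepickP rR)).
  exists (neU phi r); last by rewrite inE pc.
  apply/cross_atomsP; right; exists phi, r; split=> //; split=> //.
  by apply/belowP; exists (nepick rR); rewrite ?nepickP.
rewrite negb_and negbK => H; exists phi => //.
by apply/cross_atomsP; left; split=> // pL; move: H; rewrite pL.
Qed.

Lemma rename_setP (D : {set Omega}) X (U : neset Omega) c :
  reflect (exists2 x, x \in nval U & if x \in D then c \in nval (X x) else c == x)
          (c \in nval (rename_set D X U)).
Proof.
apply: (iffP setUP) => [[/setDP[Uc Dc]|/bigcupP[x /setIP[Ux Dx] Xc]]|[x Ux]].
- by exists c; rewrite // (negPf Dc).
- by exists x; rewrite // Dx.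
case: ifPn => [Dx Xc|Dx /eqP->]; [right|by left; rewrite inE Dx].
by apply/bigcupP; exists x; rewrite // inE Ux.
Qed.

Theorem rename_atomizes (D : {set Omega}) X A K :
  atomizes A K ->
  atomizes [set rename_set D X phi | phi in A] (rename D X K).
Proof.
move=> AK; have /atomizesP[KC CK _] := atoms_in_atomizes K.
have mono (U V : neset Omega) : nval U \subset nval V ->
    nval (rename_set D X U) \subset nval (rename_set D X V).
  move=> UV; apply/subsetP => c /rename_setP[x Ux H]; apply/rename_setP.
  by exists x; rewrite ?(subsetP UV).
apply: of_atoms_atomizes_sub.
- by apply: imsetS; exact: atomizes_sub.
- by move=> _ /imsetP[phi /KC H ->]; apply: mono.
- move=> c /rename_setP[x Kx H]; have [phi Kp px] := CK x Kx.
  by exists (rename_set D X phi); [exact: imset_f | apply/rename_setP; exists x].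
move=> _ c /imsetP[phi Kp ->] /rename_setP[x px H].
have [eta Ae /andP[ex ep]] := atoms_in_cover AK Kp px.
exists (rename_set D X eta); rewrite ?imset_f // mono // andbT.
by apply/rename_setP; exists x.
Qed.

End Atomizations.

(* Main.v *)
Require Import Defs.
From HB Require Import structures.
From mathcomp Require Import all_boot all_order.
Set Implicit Arguments.
Unset Strict Implicit.
Unset Printing Implicit Defensive.

Import Order.Theory Order.SetSubsetOrder.Exports Defs.

(** Since (t1, t2) <= (s1, s2) in the product iff both coordinates are ordered,
    M ⊗ N is atomized by the cylinders phi x C_N and C_M x psi, for phi in M and
    psi in N; this is (ii).  The non-redundant atoms of a model atomize it and lie in all
    its atomizations, in particular in the one by the cylinders over non-redundant
    atoms, whence (iii).  For (i), a full crossing keeps exactly those atoms phi in K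
    with phi < rL -> phi < rR; an atom surviving all crossings contains a_i or b_j
    iff it contains g_ij.  Such atoms include phi together with its cylinder,
    and any of them containing a_i contains an atom of M below a_i along with its
    cylinder. *)

(** * Atoms in a model, full crossings and non-redundant atoms *)

Section AtomsIn.
Variable Omega : finType.
Implicit Types (M N K : model Omega) (C : neset Omega) (s t : term Omega).
Implicit Types (phi psi eta : atom Omega) (A B : {set atom Omega}).

Lemma eq_model_atomizes A M N :
  consts M = consts N -> atomizes A M -> atomizes A N -> M ≡ N.
Proof.
move=> eC /atomizesP[_ _ HM] /atomizesP[_ _ HN]; split=> // t s tC sC.
by rewrite HM // HN // -eC.
Qed.

Lemma atoms_in_neU M phi psi :
  phi \in atoms_in M -> psi \in atoms_in M -> neU phi psi \in atoms_in M.
Proof.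
rewrite atoms_inE !inE => /consistentP[pC Hp] /consistentP[qC Hq].
apply/consistentP; split=> [|t s tC sC ts]; first by rewrite subUset pC.
rewrite !below_neU => /orP[/(Hp t s tC sC ts)->//|/(Hq t s tC sC ts)->].
by rewrite orbT.
Qed.

(** Every atom in [M] is a union of members of [A] contained in it. A largest member of [A] inside
    [phi] absorbs all the others, by closure under unions, and hence is all of [phi]. *)
Lemma atoms_in_neU_closed A M :
  atomizes A M -> {in A &, forall phi psi, neU phi psi \in A} ->
  atoms_in M = A.
Proof.
move=> AM AU; apply/eqP; rewrite eqEsubset atomizes_sub // andbT.
apply/subsetP => phi Mphi; have cov := atoms_in_cover AM Mphi.
have [eta0 Aeta0 /andP[_ eta0p]] := cov _ (nepickP phi).
pose P eta := (eta \in A) && (nval eta \subset nval phi).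
have P0 : P eta0 by rewrite /P Aeta0.
case: (@arg_maxnP _ eta0 P (fun eta => #|nval eta|) P0).
move=> eta /andP[Aeta etap] maxeta.
suff -> : phi = eta by [].
apply/val_inj/eqP; rewrite eqEsubset etap andbT; apply/subsetP => c pc.
have [eta' Aeta' /andP[ce' e'p]] := cov _ pc.
have /maxeta leU : P (neU eta eta') by rewrite /P AU //= subUset etap.
have /eqP eqU : nval eta == nval (neU eta eta') by rewrite eqEcard subsetUl.
have : c \in nval (neU eta eta') by rewrite inE ce' orbT.
by rewrite -eqU.
Qed.

(** These are the atoms compatible with the inequality rL <= rR. *)
Definition survivors (rL rR : term Omega) : {set atom Omega} :=
  [set phi | below phi rL ==> below phi rR].

(** The atoms in [K] are closed under union, so each atom [neU lambda rho] added by the crossing is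
    already among them, and the crossing only deletes the atoms that violate rL <= rR. What remains
    is again closed under union, so it is the set of all atoms in the crossed model. *)
Lemma atoms_in_cross (rL rR : term Omega) K :
  nval rL \subset nval (consts K) -> nval rR \subset nval (consts K) ->
  atoms_in (cross rL rR K) = atoms_in K :&: survivors rL rR.
Proof.
move=> rLC rRC; have := cross_atomizes rLC rRC (atoms_in_atomizes K).
have -> : cross_atoms rL rR (atoms_in K) = atoms_in K :&: survivors rL rR.
  apply/setP => phi; rewrite [in RHS]inE [in X in _ && X]inE.
  apply/cross_atomsP/andP => [[[Kp /implyP]|]|[Kp /implyP]].
  - by [].
  - move=> [l [r [Kl lL lR Kr [rR' ->]]]]; rewrite atoms_in_neU //.
    by rewrite !below_neU rR' orbT implybT.
  by left.
move/atoms_in_neU_closed; apply => phi psi.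
rewrite [phi \in _]inE [psi \in _]inE => /andP[Kp Hp] /andP[Kq Hq].
rewrite inE atoms_in_neU //=; move: Hp Hq; rewrite !inE !below_neU.
by case: (below phi rL); case: (below phi rR); case: (below psi rL);
   case: (below psi rR).
Qed.

Lemma nonredundantP M phi :
  reflect (phi \in atoms_in M /\ exists2 c, c \in nval phi &
             forall eta, eta \in atoms_in M -> c \in nval eta ->
               ~~ (nval eta \proper nval phi))
          (phi \in nonredundant M).
Proof.
rewrite [X in reflect _ X]inE /redundant.
apply: (iffP andP) => -[Mp].
  case/forall_inPn => c Cc; rewrite negb_imply below1 => /andP[pc].
  move/exists_inPn => H; split=> //; exists c => // eta Me ec.
  by have := H eta Me; rewrite below1 ec.
case=> c pc H; split=> //; apply/forall_inPn; exists c.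
  have /atomizesP[MC _ _] := atoms_in_atomizes M.
  exact: (subsetP (MC _ Mp)).
rewrite negb_imply below1 pc; apply/exists_inPn => eta Me.
by rewrite below1 negb_and -implybE; apply/implyP; exact: H.
Qed.

(** The cover by [A] is applied at the constant that witnesses non-redundancy: the member of [A]
    found there inside [phi] cannot be a proper subset, so it is [phi]. *)
Lemma nonredundant_sub A M : atomizes A M -> nonredundant M \subset A.
Proof.
move=> AM; apply/subsetP => phi /nonredundantP[Mp [c pc min]].
have [eta Ae /andP[ec ep]] := atoms_in_cover AM Mp pc.
have := min _ (subsetP (atomizes_sub AM) _ Ae) ec.
rewrite properE ep negbK => pe; suff -> : phi = eta by [].
by apply/val_inj/eqP; rewrite eqEsubset pe.
Qed.

Lemma nonredundant_cover M phi c : phi \in atoms_in M -> c \in nval phi ->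
  exists2 eta, eta \in nonredundant M & (c \in nval eta) && (nval eta \subset nval phi).
Proof.
move=> Mp pc; pose P eta :=
  [&& eta \in atoms_in M, c \in nval eta & nval eta \subset nval phi].
have P0 : P phi by rewrite /P Mp pc subxx.
(* An atom of least size among those inside [phi] that contain [c] is non-redundant, with witness
   [c]. *)
case: (@arg_minnP _ phi P (fun eta => #|nval eta|) P0).
move=> eta /and3P[Me ec ep] min; exists eta; last by rewrite ec.
apply/nonredundantP; split=> //; exists c => // psi Mpsi psic.
apply/negP => pe; have := proper_card pe; rewrite ltnNge => /negP[].
by apply: min; rewrite /P Mpsi psic (subset_trans (proper_sub pe)).
Qed.

Lemma nonredundant_atomizes M : atomizes (nonredundant M) M.
Proof.
have /atomizesP[MC CM HM] := atoms_in_atomizes M.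
have sub : nonredundant M \subset atoms_in M.
  by apply/subsetP => phi /nonredundantP[].
apply/atomizesP; split=> [phi /(subsetP sub)/MC //|c /CM[phi Mp pc]|t s tC sC].
  by have [eta Ne /andP[ec _]] := nonredundant_cover Mp pc; exists eta.
rewrite HM //; congr (~~ _); apply/idP/idP; last exact: separates_sub.
by apply: separates_cover => phi c; exact: nonredundant_cover.
Qed.

(** The order of terms in the free model is inclusion of component sets, so no atom over [C] can
    contradict it. *)
Lemma atoms_in_free C phi :
  nval phi \subset nval C -> phi \in atoms_in (free_model C).
Proof.
move=> pC; rewrite atoms_inE inE; apply/consistentP; split=> // t s tC sC.
rewrite gen_model_le // joins_le => /forall_inP ts /belowP[c tc pc].
have ss : (joins (fun x => [set x] : subsets Omega) s <= (nval s : subsets Omega))%O.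
  by rewrite joins_le; apply/forall_inP => x xs; rewrite Order.SetSubsetOrder.leEsubset sub1set.
apply/belowP; exists c => //; have := le_trans (ts c tc) ss.
by rewrite Order.SetSubsetOrder.leEsubset sub1set.
Qed.

Lemma joins_nemap d (L : joinSemilatticeType d) (f : Omega -> L)
    (h : Omega -> Omega) t :
  joins f (nemap h t) = joins (f \o h) t.
Proof.
apply/le_anti; rewrite !joins_le; apply/andP; split; apply/forall_inP => c.
  by case/imsetP => x tx ->; exact: (@le_joins _ _ _ (f \o h)).
by move=> tc; rewrite [leLHS]/=; apply: (le_joins f); exact: imset_f.
Qed.

End AtomsIn.

(** * Cylinders and the product model *)

Section Cylinders.
Variables (Omega : finType) (M N : model Omega) (g : Omega -> Omega -> Omega).
Hypothesis g_inj : {in setX (nval (consts M)) (nval (consts N)) &,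
                      injective (fun p => g p.1 p.2)}.
Implicit Types (s t : term Omega) (phi psi : atom Omega) (A B : {set atom Omega}).

Definition cyl1 phi : atom Omega := nemap2 g phi (consts N).
Definition cyl2 psi : atom Omega := nemap2 g (consts M) psi.

(** A left inverse of [g] on C_M x C_N. It repeats the search made in [prod_interp], so that
    [prod_interp M N g c] is by conversion the pair of interpretations at [coords c]; the default
    [(c, c)] is reached only off the image of [g]. *)
Definition coords (c : Omega) : Omega * Omega :=
  odflt (c, c) [pick p in setX (nval (consts M)) (nval (consts N))
                | g p.1 p.2 == c].

Lemma coordsE x y :
  x \in nval (consts M) -> y \in nval (consts N) -> coords (g x y) = (x, y).
Proof.
move=> Mx Ny; have Dxy : (x, y) \in setX (nval (consts M)) (nval (consts N)).
  by rewrite in_setX Mx Ny.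
rewrite /coords; case: pickP => [p /andP[Dp /eqP gp]|/(_ (x, y))] /=.
  exact: g_inj.
by rewrite Dxy eqxx.
Qed.

Lemma prod_constsP c :
  reflect (exists x y, [/\ x \in nval (consts M), y \in nval (consts N) & c = g x y])
          (c \in nval (prod_consts M N g)).
Proof.
apply: (iffP imset2P) => [[x y Mx Ny ->]|[x [y [Mx Ny ->]]]]; first by exists x, y.
by exists x y.
Qed.

Lemma mem_cyl1 phi x y : nval phi \subset nval (consts M) ->
  x \in nval (consts M) -> y \in nval (consts N) ->
  (g x y \in nval (cyl1 phi)) = (x \in nval phi).
Proof.
move=> pC Mx Ny; apply/imset2P/idP => [[x' y' px' Ny' /(congr1 coords)]|px].
  by rewrite !coordsE // ?(subsetP pC) // => -[->].
by exists x y.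
Qed.

Lemma mem_cyl2 psi x y : nval psi \subset nval (consts N) ->
  x \in nval (consts M) -> y \in nval (consts N) ->
  (g x y \in nval (cyl2 psi)) = (y \in nval psi).
Proof.
move=> pC Mx Ny; apply/imset2P/idP => [[x' y' Mx' py' /(congr1 coords)]|py].
  by rewrite !coordsE // ?(subsetP pC) // => -[_ ->].
by exists x y.
Qed.

Lemma cyl1_sub phi : nval phi \subset nval (consts M) ->
  nval (cyl1 phi) \subset nval (prod_consts M N g).
Proof. by move=> pC; apply: imset2S. Qed.

Lemma cyl2_sub psi : nval psi \subset nval (consts N) ->
  nval (cyl2 psi) \subset nval (prod_consts M N g).
Proof. by move=> pC; apply: imset2S. Qed.

Definition coord1 t : term Omega := nemap (fun c => (coords c).1) t.
Definition coord2 t : term Omega := nemap (fun c => (coords c).2) t.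

Lemma coord1_sub t : nval t \subset nval (prod_consts M N g) ->
  nval (coord1 t) \subset nval (consts M).
Proof.
move=> tG; apply/subsetP => _ /imsetP[c /(subsetP tG)/prod_constsP[x [y [Mx Ny ->]]] ->].
by rewrite coordsE.
Qed.

Lemma coord2_sub t : nval t \subset nval (prod_consts M N g) ->
  nval (coord2 t) \subset nval (consts N).
Proof.
move=> tG; apply/subsetP => _ /imsetP[c /(subsetP tG)/prod_constsP[x [y [Mx Ny ->]]] ->].
by rewrite coordsE.
Qed.

(** A constant g_ij of [t] lies in the cylinder exactly when a_i lies in [phi]: the cylinder sees
    only the first coordinate of a term. *)
Lemma below_cyl1 phi t : nval phi \subset nval (consts M) ->
  nval t \subset nval (prod_consts M N g) ->
  below (cyl1 phi) t = below phi (coord1 t).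
Proof.
move=> pC tG; apply/belowP/belowP => [[c tc]|[_ /imsetP[c tc ->]]].
  have /prod_constsP[x [y [Mx Ny Ec]]] := subsetP tG _ tc; subst c.
  rewrite mem_cyl1 // => px; exists x => //; apply/imsetP; exists (g x y) => //.
  by rewrite coordsE.
have /prod_constsP[x [y [Mx Ny Ec]]] := subsetP tG _ tc; subst c.
by rewrite coordsE //= => px; exists (g x y); rewrite // mem_cyl1.
Qed.

Lemma below_cyl2 psi t : nval psi \subset nval (consts N) ->
  nval t \subset nval (prod_consts M N g) ->
  below (cyl2 psi) t = below psi (coord2 t).
Proof.
move=> pC tG; apply/belowP/belowP => [[c tc]|[_ /imsetP[c tc ->]]].
  have /prod_constsP[x [y [Mx Ny Ec]]] := subsetP tG _ tc; subst c.
  rewrite mem_cyl2 // => py; exists y => //; apply/imsetP; exists (g x y) => //.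
  by rewrite coordsE.
have /prod_constsP[x [y [Mx Ny Ec]]] := subsetP tG _ tc; subst c.
by rewrite coordsE //= => py; exists (g x y); rewrite // mem_cyl2.
Qed.

Lemma nu_prod t : nu (prod_model g_inj) t = (nu M (coord1 t), nu N (coord2 t)).
Proof.
rewrite /nu !joins_nemap.
apply/le_anti; rewrite joins_le leEprod /= !joins_le; apply/and3P; split;
  apply/forall_inP => c tc.
- rewrite leEprod; apply/andP; split.
    exact: (le_joins (fun c => interp M (coords c).1) tc).
  exact: (le_joins (fun c => interp N (coords c).2) tc).
- by have := le_joins (prod_interp M N g) tc; rewrite leEprod => /andP[].
- by have := le_joins (prod_interp M N g) tc; rewrite leEprod => /andP[].
Qed.

Lemma prod_atomizes A B : atomizes A M -> atomizes B N ->
  atomizes ([set cyl1 phi | phi in A] :|: [set cyl2 psi | psi in B])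
           (prod_model g_inj).
Proof.
move=> /atomizesP[AC CA HA] /atomizesP[BC CB HB].
apply/atomizesP; split=> [phi|c|t s tG sG].
- by case/setUP => /imsetP[psi + ->] => [/AC|/BC]; [exact: cyl1_sub|exact: cyl2_sub].
- case/prod_constsP => x [y [Mx Ny ->]]; have [phi Ap px] := CA x Mx.
  by exists (cyl1 phi); rewrite ?mem_cyl1 ?AC // inE imset_f.
(* The product order fails iff it fails in one coordinate, and an atom witnessing the failure there
   corresponds to its cylinder in the product. *)
rewrite !nu_prod leEprod /= HA ?HB ?coord1_sub ?coord2_sub // -negb_or; congr (~~ _).
apply/orP/exists_inP => [[]/exists_inP[phi Hp]|[_ /setUP[]/imsetP[phi Hp ->]]].
- by exists (cyl1 phi); [rewrite inE imset_f|rewrite !below_cyl1 ?AC].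
- by exists (cyl2 phi); [rewrite inE [X in _ || X]imset_f ?orbT|rewrite !below_cyl2 ?BC].
- by rewrite !below_cyl1 ?AC // => H; left; apply/exists_inP; exists phi.
- by rewrite !below_cyl2 ?BC // => H; right; apply/exists_inP; exists phi.
Qed.

Lemma prod_nonredundant :
  exists A, [/\ atomizes A (prod_model g_inj), A \subset nonredundant (prod_model g_inj)
              & #|A| <= #|nonredundant M| + #|nonredundant N|].
Proof.
exists (nonredundant (prod_model g_inj)); split=> //.
  exact: nonredundant_atomizes.
(* This atomization of the product contains all its non-redundant atoms, which bounds their
   number. *)
have cyls := prod_atomizes (nonredundant_atomizes M) (nonredundant_atomizes N).
apply: leq_trans (subset_leq_card (nonredundant_sub cyls)) _.
apply: leq_trans (leq_card_setU _ _) _.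
by apply: leq_add; exact: leq_imset_card.
Qed.

(** * Renaming constants into cylinders *)

Hypothesis disjMN : [disjoint nval (consts M) & nval (consts N)].
Hypothesis g_fresh : [disjoint nval (prod_consts M N g)
                       & nval (consts M) :|: nval (consts N)].

Lemma g_fresh1 x y : x \in nval (consts M) -> y \in nval (consts N) ->
  g x y \notin nval (consts M).
Proof.
move=> Mx Ny; have gG : g x y \in nval (prod_consts M N g) by exact: imset2_f.
by have := disjointFr g_fresh gG; rewrite inE => /norP[].
Qed.

Lemma g_fresh2 x y : x \in nval (consts M) -> y \in nval (consts N) ->
  g x y \notin nval (consts N).
Proof.
move=> Mx Ny; have gG : g x y \in nval (prod_consts M N g) by exact: imset2_f.
by have := disjointFr g_fresh gG; rewrite inE => /norP[].
Qed.

Let rename2 := rename_set (nval (consts N)) (fun y => nemap (fun x => g x y) (consts M)).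
Let rename1 := rename_set (nval (consts M)) (fun x => nemap (fun y => g x y) (consts N)).

(** The constants g_ij created by the first renaming are fresh, so the second leaves them alone; the
    a_i, lying outside C_N, pass unchanged through the first. *)
Lemma rename_cylP (U : neset Omega) c :
  nval U \subset nval (consts M) :|: nval (consts N) ->
  reflect (exists x y, [/\ x \in nval (consts M), y \in nval (consts N),
                          c = g x y & (x \in nval U) || (y \in nval U)])
          (c \in nval (rename1 (rename2 U))).
Proof.
move=> UC; apply: (iffP (rename_setP _ _ _ _)).
  case=> z /rename_setP[u Uu].
  case: ifPn => [Nu /imsetP[x Mx ->]|Nu /eqP->].
    rewrite (negPf (g_fresh1 Mx Nu)) => /eqP->.
    by exists x, u; rewrite Uu orbT.
  have := subsetP UC _ Uu; rewrite inE (negPf Nu) orbF => Mu.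
  by rewrite Mu => /imsetP[y Ny ->]; exists u, y; rewrite Uu.
case=> x [y [Mx Ny -> /orP[Ux|Uy]]].
  exists x; last by rewrite Mx imset_f.
  by apply/rename_setP; exists x; rewrite // (disjointFr disjMN Mx).
exists (g x y); last by rewrite (negPf (g_fresh1 Mx Ny)).
by apply/rename_setP; exists y; rewrite // Ny imset_f.
Qed.

Lemma rename_cyl1 phi : nval phi \subset nval (consts M) ->
  rename1 (rename2 phi) = cyl1 phi.
Proof.
move=> pC; apply/val_inj/setP => c.
apply/(rename_cylP _ (subset_trans pC (subsetUl _ _)))/imset2P.
  case=> x [y [Mx Ny -> /orP[px|/(subsetP pC) My]]]; first by exists x y.
  by rewrite (disjointFr disjMN My) in Ny.
by case=> x y px Ny ->; exists x, y; rewrite px (subsetP pC).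
Qed.

Lemma rename_cyl2 psi : nval psi \subset nval (consts N) ->
  rename1 (rename2 psi) = cyl2 psi.
Proof.
move=> pC; apply/val_inj/setP => c.
apply/(rename_cylP _ (subset_trans pC (subsetUr _ _)))/imset2P.
  case=> x [y [Mx Ny -> /orP[/(subsetP pC) Nx|py]]]; last by exists x y.
  by rewrite (disjointFr disjMN Mx) in Nx.
by case=> x y Mx py ->; exists x, y; rewrite py orbT (subsetP pC).
Qed.

Lemma prod_rename :
  prod_model g_inj ≡
    rename (nval (consts M)) (fun x => nemap (fun y => g x y) (consts N))
      (rename (nval (consts N)) (fun y => nemap (fun x => g x y) (consts M))
         (union M N)).
Proof.
have /atomizesP[MC _ _] := atoms_in_atomizes M.
have /atomizesP[NC _ _] := atoms_in_atomizes N.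
(* Both sides have one atomization in common, the cylinders over all atoms in [M] and in [N]. *)
apply: eq_model_atomizes (prod_atomizes (atoms_in_atomizes M) (atoms_in_atomizes N)) _.
  apply/val_inj/setP => c; apply/prod_constsP/(@rename_cylP (neU (consts M) (consts N)) c (subxx _)).
    by case=> x [y [Mx Ny ->]]; exists x, y; split=> //; rewrite inE Mx.
  by case=> x [y [Mx Ny -> _]]; exists x, y.
have := rename_atomizes (nval (consts M)) (fun x => nemap (fun y => g x y) (consts N))
  (rename_atomizes (nval (consts N)) (fun y => nemap (fun x => g x y) (consts M))
    (union_atomizes (atoms_in_atomizes M) (atoms_in_atomizes N))).
congr (atomizes _ _); rewrite -imset_comp imsetU; congr (_ :|: _).
  by apply: eq_in_imset => phi /MC; exact: rename_cyl1.
by apply: eq_in_imset => phi /NC; exact: rename_cyl2.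
Qed.

(** * Balanced atoms and the restriction to G *)

Let K0 := union (union M N) (free_model (prod_consts M N g)).

Lemma atoms_in_base1 phi : phi \in atoms_in M -> phi \in atoms_in K0.
Proof.
move=> Mp; have /atomizes_sub/subsetP := union_atomizes
  (union_atomizes (atoms_in_atomizes M) (atoms_in_atomizes N))
  (atoms_in_atomizes (free_model (prod_consts M N g))).
by apply; rewrite in_setU in_setU Mp.
Qed.

Lemma atoms_in_base2 psi : psi \in atoms_in N -> psi \in atoms_in K0.
Proof.
move=> Np; have /atomizes_sub/subsetP := union_atomizes
  (union_atomizes (atoms_in_atomizes M) (atoms_in_atomizes N))
  (atoms_in_atomizes (free_model (prod_consts M N g))).
by apply; rewrite in_setU in_setU Np orbT.
Qed.

Lemma atoms_in_base3 phi :
  nval phi \subset nval (prod_consts M N g) -> phi \in atoms_in K0.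
Proof.
move=> pG; have /atomizes_sub/subsetP := union_atomizes
  (union_atomizes (atoms_in_atomizes M) (atoms_in_atomizes N))
  (atoms_in_atomizes (free_model (prod_consts M N g))).
by apply; rewrite in_setU atoms_in_free // orbT.
Qed.

Lemma atoms_in_base_cover phi c : phi \in atoms_in K0 -> c \in nval phi ->
  exists2 eta, (c \in nval eta) && (nval eta \subset nval phi) &
    [|| eta \in atoms_in M, eta \in atoms_in N
      | nval eta \subset nval (prod_consts M N g)].
Proof.
have /atomizesP[FC _ _] := atoms_in_atomizes (free_model (prod_consts M N g)).
move=> Kp pc; have [eta + He] := atoms_in_cover (union_atomizes
  (union_atomizes (atoms_in_atomizes M) (atoms_in_atomizes N))
  (atoms_in_atomizes (free_model (prod_consts M N g)))) Kp pc.
by rewrite in_setU in_setU -orbA => H; exists eta => //;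
  case/or3P: H => [->|->|/FC->]; rewrite ?orbT.
Qed.

(** Balance at (i, j) is compatibility with g_ij <= a_i ⊙ b_j and with its converse, so among the
    atoms in [K0] these are the ones that survive every crossing. *)
Definition balanced : {set atom Omega} :=
  [set phi | [forall x in nval (consts M), forall y in nval (consts N),
     (g x y \in nval phi) == (x \in nval phi) || (y \in nval phi)]].

Lemma balancedP phi :
  reflect (forall x y, x \in nval (consts M) -> y \in nval (consts N) ->
             (g x y \in nval phi) = (x \in nval phi) || (y \in nval phi))
          (phi \in balanced).
Proof.
rewrite inE; apply: (iffP forall_inP) => [H x y Mx Ny|H x Mx].
  by have /forall_inP/(_ y Ny)/eqP := H x Mx.
by apply/forall_inP => y Ny; apply/eqP; exact: H.
Qed.

(** No b_j occurs in the union, [phi] contains no g_ij, and the cylinder consists of constants g_ij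
    only, namely those with a_i in [phi]. *)
Lemma balanced_cyl1 phi : nval phi \subset nval (consts M) ->
  neU phi (cyl1 phi) \in balanced.
Proof.
move=> pC; apply/balancedP => x y Mx Ny.
have G0 : g x y \in nval phi = false.
  by apply: contraNF (g_fresh1 Mx Ny) => /(subsetP pC).
have py : y \in nval phi = false.
  by apply/negP => /(subsetP pC) My; rewrite (disjointFr disjMN My) in Ny.
have cG z : z \in nval (consts M) :|: nval (consts N) -> z \in nval (cyl1 phi) = false.
  by move=> Hz; apply: contraTF Hz => /(subsetP (cyl1_sub pC)) Gz; rewrite (disjointFr g_fresh Gz).
by rewrite !inE G0 py mem_cyl1 // !cG ?orbF // inE ?Mx ?Ny ?orbT.
Qed.

Lemma balanced_cyl2 psi : nval psi \subset nval (consts N) ->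
  neU psi (cyl2 psi) \in balanced.
Proof.
move=> pC; apply/balancedP => x y Mx Ny.
have G0 : g x y \in nval psi = false.
  by apply: contraNF (g_fresh2 Mx Ny) => /(subsetP pC).
have px : x \in nval psi = false.
  by apply/negP => /(subsetP pC); rewrite (disjointFr disjMN Mx).
have cG z : z \in nval (consts M) :|: nval (consts N) -> z \in nval (cyl2 psi) = false.
  by move=> Hz; apply: contraTF Hz => /(subsetP (cyl2_sub pC)) Gz; rewrite (disjointFr g_fresh Gz).
by rewrite !inE G0 px mem_cyl2 // !cG ?orbF // inE ?Mx ?Ny ?orbT.
Qed.

(** Terms over G do not meet C_M or C_N. Hence [neU phi (cyl1 phi)] separates the same terms over G
    as the cylinder alone. *)
Lemma below_neU_fresh phi psi t :
  nval phi \subset nval (consts M) :|: nval (consts N) ->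
  nval t \subset nval (prod_consts M N g) ->
  below (neU phi psi) t = below psi t.
Proof.
move=> pC tG; rewrite below_neU; case: belowP => // -[c tc /(subsetP pC)].
by rewrite (disjointFr g_fresh (subsetP tG _ tc)).
Qed.

(** Balance at c = g x y puts x or y in [phi]. By disjointness, a covering atom through x can only
    come from [M], and one through y only from [N]; balance then forces its whole cylinder into
    [phi]. *)
Lemma balanced_cover phi c : phi \in atoms_in K0 -> phi \in balanced ->
  c \in nval phi -> c \in nval (prod_consts M N g) ->
  exists2 eta, (eta \in [set cyl1 psi | psi in atoms_in M]
                     :|: [set cyl2 psi | psi in atoms_in N])
             & (c \in nval eta) && (nval eta \subset nval phi).
Proof.
have /atomizesP[MC _ _] := atoms_in_atomizes M.
have /atomizesP[NC _ _] := atoms_in_atomizes N.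
move=> Kp /balancedP bal pc /prod_constsP[x [y [Mx Ny Ec]]]; subst c.
have notG z (eta : neset Omega) : z \in nval (consts M) :|: nval (consts N) ->
    z \in nval eta -> ~~ (nval eta \subset nval (prod_consts M N g)).
  move=> Hz ez; apply: contraTN Hz => /subsetP/(_ _ ez) Gz.
  by rewrite (disjointFr g_fresh Gz).
move: pc; rewrite bal // => /orP[] p_.
  have [eta /andP[ex ep]] := atoms_in_base_cover Kp p_.
  have xMN : x \in nval (consts M) :|: nval (consts N) by rewrite inE Mx.
  rewrite (negPf (notG _ _ xMN ex)) orbF.
  case/orP => [Me|Ne]; last first.
    by have := subsetP (NC _ Ne) _ ex; rewrite (disjointFr disjMN Mx).
  exists (cyl1 eta); first by rewrite inE imset_f.
  rewrite mem_cyl1 ?MC // ex; apply/subsetP => _ /imset2P[u v eu Nv ->].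
  by rewrite bal ?(subsetP (MC _ Me)) // (subsetP ep).
have [eta /andP[ey ep]] := atoms_in_base_cover Kp p_.
have yMN : y \in nval (consts M) :|: nval (consts N) by rewrite inE Ny orbT.
rewrite (negPf (notG _ _ yMN ey)) orbF.
case/orP => [Me|Ne].
  by have := subsetP (MC _ Me) _ ey => My; rewrite (disjointFr disjMN My) in Ny.
exists (cyl2 eta); first by rewrite inE [X in _ || X]imset_f ?orbT.
rewrite mem_cyl2 ?NC // ey; apply/subsetP => _ /imset2P[u v Mu ev ->].
by rewrite bal ?(subsetP (NC _ Ne)) // [X in _ || X](subsetP ep _ ev) orbT.
Qed.

Lemma prod_restrict K : nval (prod_consts M N g) \subset nval (consts K) ->
  atoms_in K = atoms_in K0 :&: balanced ->
  prod_model g_inj ≡ restrict (prod_consts M N g) K.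
Proof.
move=> GK EK; split=> // t s tG sG.
have /atomizesP[MC _ _] := atoms_in_atomizes M.
have /atomizesP[NC _ _] := atoms_in_atomizes N.
have /atomizesP[_ _ ->] // :=
  prod_atomizes (atoms_in_atomizes M) (atoms_in_atomizes N).
(* The restriction inherits the order of [K] on terms over G, so both sides reduce to separation by
   atoms. *)
rewrite gen_model_le // -[joins _ t]/(nu K t) -[joins _ s]/(nu K s).
have /atomizesP[_ _ ->] := atoms_in_atomizes K; rewrite ?(subset_trans _ GK) //.
congr (~~ _); rewrite EK; apply/exists_inP/exists_inP => -[phi].
  (* Adding its base atom to a separating cylinder makes it balanced and changes nothing for terms
     over G. *)
  case/setUP => /imsetP[psi Hpsi ->] sep; [have pC := MC _ Hpsi|have pC := NC _ Hpsi].
    exists (neU psi (cyl1 psi)).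
      rewrite in_setI balanced_cyl1 // andbT.
      apply: atoms_in_neU; first exact: atoms_in_base1.
      by apply: atoms_in_base3; exact: cyl1_sub.
    by rewrite !below_neU_fresh // (subset_trans pC) ?subsetUl.
  exists (neU psi (cyl2 psi)).
    rewrite in_setI balanced_cyl2 // andbT.
      apply: atoms_in_neU; first exact: atoms_in_base2.
      by apply: atoms_in_base3; exact: cyl2_sub.
  by rewrite !below_neU_fresh // (subset_trans pC) ?subsetUr.
(* Conversely, a cylinder inside a separating balanced atom still separates if it keeps a constant
   of [t]. *)
case/setIP => Kp bal /andP[/belowP[c tc pc] Nps].
have [eta He /andP[ec ep]] := balanced_cover Kp bal pc (subsetP tG _ tc).
exists eta => //; apply/andP; split; first by apply/belowP; exists c.
by apply: contra Nps; exact: below_sub.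
Qed.

End Cylinders.

(** * Compositions of crossings *)

Section Composition.
Variable Omega : finType.
Implicit Types (K : model Omega) (C : neset Omega) (F : model Omega -> model Omega).
Implicit Types S : {set atom Omega}.

(** Quantifying over all models over [C] makes the property compose: the constants are kept and
    successive operators intersect their sets of atoms. *)
Definition selects C F S :=
  forall K, consts K = C -> consts (F K) = C /\ atoms_in (F K) = atoms_in K :&: S.

Lemma selects_comp C F1 F2 S1 S2 :
  selects C F1 S1 -> selects C F2 S2 -> selects C (F1 \o F2) (S1 :&: S2).
Proof.
move=> H1 H2 K KC; have [C2 E2] := H2 K KC; have [C1 E1] := H1 _ C2.
by split=> //=; rewrite E1 E2 setIAC setIA.
Qed.

Lemma selects_big C m (F : 'I_m -> model Omega -> model Omega)
    (S : 'I_m -> {set atom Omega}) :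
  (forall i, selects C (F i) (S i)) ->
  selects C (\big[(fun F1 F2 => F1 \o F2)/id]_(i < m) F i) (\bigcap_(i < m) S i).
Proof.
move=> H; elim/big_rec2: _ => [|i S' F' _ IH]; last exact: selects_comp.
(* The empty composition is the identity, which keeps all atoms. *)
by move=> K; rewrite setIT.
Qed.

Lemma selects_cross C (rL rR : term Omega) :
  nval rL \subset nval C -> nval rR \subset nval C ->
  selects C (cross rL rR) (survivors rL rR).
Proof. by move=> HL HR K KC; split=> //; rewrite atoms_in_cross // KC. Qed.

End Composition.

Theorem theorem36 (Omega : finType) (M N : model Omega) (m n : nat)
    (a : 'I_m -> Omega) (b : 'I_n -> Omega) (g : Omega -> Omega -> Omega)
    (a_inj : injective a) (b_inj : injective b)
    (CM : nval (consts M) = [set a i | i : 'I_m])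
    (CN : nval (consts N) = [set b j | j : 'I_n])
    (CM_CN_disjoint : [disjoint nval (consts M) & nval (consts N)])
    (g_inj : {in setX (nval (consts M)) (nval (consts N)) &,
                injective (fun p => g p.1 p.2)})
    (g_fresh : [disjoint nval (nemap2 g (consts M) (consts N))
                  & nval (consts M) :|: nval (consts N)]) :
  let G := nemap2 g (consts M) (consts N) in
  let MxN := prod_model g_inj in
  let comp := fun F1 F2 : model Omega -> model Omega => F1 \o F2 in
  [/\ MxN ≡
        restrict G
          ((\big[comp/id]_(i < m) \big[comp/id]_(j < n)
              (cross (ne1 (g (a i) (b j))) (neU (ne1 (a i)) (ne1 (b j)))
               \o cross (neU (ne1 (a i)) (ne1 (b j))) (ne1 (g (a i) (b j)))))
             (union (union M N) (free_model G))),
      MxN ≡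
        rename (nval (consts M)) (fun x => nemap (fun y => g x y) (consts N))
          (rename (nval (consts N)) (fun y => nemap (fun x => g x y) (consts M))
             (union M N))
    & exists A : {set atom Omega},
        [/\ atomizes A MxN,
            A \subset nonredundant MxN
          & #|A| <= #|nonredundant M| + #|nonredundant N|]].
Proof.
move=> G MxN comp; split; [|exact: prod_rename|exact: prod_nonredundant].
have aM i : a i \in nval (consts M) by rewrite CM imset_f.
have bN j : b j \in nval (consts N) by rewrite CN imset_f.
(* The constants of the union model, over which all the crossed terms lie. *)
set C := neU (neU (consts M) (consts N)) G.
have gC i j : nval (ne1 (g (a i) (b j))) \subset nval C.
  by rewrite sub1set inE; apply/orP; right; exact: imset2_f.
have abC i j : nval (neU (ne1 (a i)) (ne1 (b j))) \subset nval C.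
  by rewrite subUset !sub1set !inE aM bN !orbT.
have [] := @selects_big _ C m _ _ (fun i => selects_big (fun j =>
  selects_comp (selects_cross (gC i j) (abC i j)) (selects_cross (abC i j) (gC i j))))
  (union (union M N) (free_model G)) (erefl _).
move=> EC EK; apply: prod_restrict => //; first by rewrite EC subsetUr.
rewrite EK; congr (_ :&: _); apply/setP => phi.
(* The two crossings at (i, j) together impose exactly balance at (i, j). *)
have surv i j : phi \in survivors (ne1 (g (a i) (b j))) (neU (ne1 (a i)) (ne1 (b j)))
      :&: survivors (neU (ne1 (a i)) (ne1 (b j))) (ne1 (g (a i) (b j)))
    = ((g (a i) (b j) \in nval phi) == (a i \in nval phi) || (b j \in nval phi)).
  by rewrite !inE !below_term_neU !below1; do 3!case: (_ \in _).
(* The enumerations [a] and [b] exhaust C_M and C_N, so conditions over all indices and over all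
   constants agree. *)
apply/bigcapP/balancedP => [H x y|H i _].
  rewrite CM CN => /imsetP[i _ ->] /imsetP[j _ ->]; apply/eqP; rewrite -surv.
  by have /bigcapP := H i isT; apply.
by apply/bigcapP => j _; rewrite surv H.
Qed.
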